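(* Let $-\infty<a<b<\infty$, let $y:[a,b]\to\mathbb{R}$ be $L$-Lipschitz and let $\gamma=\{t+iy(t):t\in[a,b]\}$. Let $\mu$ be a nonnegative measure with total mass $\beta<1$ on an open set $U\subset\mathbb{C}$ containing $\gamma$, and let $\varphi(z)=\int\log|z-\zeta|\,d\mu(\zeta)$. Then $$\int_\gamma e^{-\varphi}\,ds<C_{L,\beta,a,b},$$ where $C_{L,\beta,a,b}>0$ is a constant depending only on $L,\beta,a,b$.
   Context: $ds$ is arc length on $\gamma$: $\int_\gamma h\,ds=\int_a^b h(\gamma(t))|\gamma'(t)|dt$ with $\gamma(t)=t+iy(t)$, $|\gamma'(t)|=\sqrt{1+y'(t)^2}$. *)

(* Defs.v *)
From HB Require Import structures.
From mathcomp Require Import all_boot all_order all_algebra.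
From mathcomp Require Import all_classical all_reals all_analysis.
Set Implicit Arguments. Unset Strict Implicit. Unset Printing Implicit Defensive.
Import Order.TTheory GRing.Theory Num.Theory.
Import numFieldNormedType.Exports.
Local Open Scope classical_set_scope.
Local Open Scope ring_scope.

(* The complex plane C is modelled as R * R (z = (Re z, Im z)), with the
   product (= Borel) sigma-algebra and the product topology. *)

Definition cdist {R : realType} (z w : R * R) : R :=
  Num.sqrt ((z.1 - w.1) ^+ 2 + (z.2 - w.2) ^+ 2).

Definition elog {R : realType} (x : R) : \bar R :=
  if x == 0 then -oo%E else (ln x)%:E.

Definition log_potential {R : realType}
  (mu : {measure set (R * R)%type -> \bar R}) (z : R * R) : \bar R :=
  (\int[mu]_(zeta in setT) elog (cdist z zeta))%E.

Definition lipschitz_on_itv {R : realType} (L a b : R) (y : R -> R) : Prop :=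
  forall s t, s \in `[a, b] -> t \in `[a, b] -> `|y s - y t| <= L * `|s - t|.

(* Line integral \int_gamma h ds over gamma(t) = t + i y(t), t in [a,b],
   with ds = |gamma'(t)| dt = sqrt(1 + y'(t)^2) dt. *)
Definition arclength_integral {R : realType} (a b : R) (y : R -> R)
  (h : R * R -> \bar R) : \bar R :=
  (\int[lebesgue_measure]_(t in `[a, b])
     (h (t, y t) * (Num.sqrt (1 + (derive1 y t) ^+ 2))%:E))%E.

(* Main.v *)
(* With gamma(t) = t + i y(t) we have |gamma(t) - zeta| >= |t - Re zeta|, so
   -phi(gamma(t)) is at most the integral of log^-|t - Re zeta| against mu.  If
   beta <= p < 1 and p > 0, Jensen's inequality bounds the exponential of that
   integral by 1 + p^-1 times the mu-integral of exp (p log^-|t - Re zeta|).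
   Since |t - x|^-p is locally integrable in t, with a bound independent of x,
   Tonelli's theorem concludes, together with ds <= sqrt (1 + L^2) dt.  Taking
   p = max (beta, 1/2) avoids treating beta = 0 separately. *)
Require Import Defs.
From HB Require Import structures.
From mathcomp Require Import all_boot all_order all_algebra.
From mathcomp Require Import all_classical all_reals all_analysis.
From mathcomp Require Import measurable_realfun.
From mathcomp Require Import ring lra.
Import Order.TTheory GRing.Theory Num.Theory.
Import numFieldNormedType.Exports.
Local Open Scope classical_set_scope.
Local Open Scope ring_scope.

(** * Jensen's inequality for the exponential *)

(** The integral of a nonnegative function is a supremum over the simple functions below it, so
    monotonicity needs no measurability. This spares proving that [derive1 y] and the potential
    along the curve are measurable. *)
Lemma ge0_le_integral_nonmeasurable d (T : measurableType d) (R : realType)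
    (mu : {measure set T -> \bar R}) (D : set T) (f g : T -> \bar R) :
  (forall x, D x -> 0 <= f x)%E -> (forall x, D x -> f x <= g x)%E ->
  (\int[mu]_(x in D) f x <= \int[mu]_(x in D) g x)%E.
Proof.
move=> f0 fg.
rewrite !ge0_integralE//; last by move=> x Dx; exact: le_trans (f0 _ Dx) (fg _ Dx).
apply: ge_ereal_sup => _ [h hf <-]; apply: ereal_sup_ubound; exists h => //= x.
exact: le_trans (hf x) (lee_restrict fg x).
Qed.

(* Jensen's inequality for a measure of total mass at most p.  With N the
   integral of f, integrate the tangent line inequality
   exp (p f) >= exp N (1 + p f - N), stated below without subtraction. *)
Lemma expeR_integral_le d (T : measurableType d) (R : realType)
    (mu : {measure set T -> \bar R}) (m p : R) (f k : T -> \bar R) :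
  0 < p -> m <= p -> mu setT = m%:E ->
  measurable_fun [set: T] f -> measurable_fun [set: T] k ->
  (forall x, 0 <= f x)%E -> (forall x, expeR (p%:E * f x) <= k x)%E ->
  (expeR (\int[mu]_x f x) <= 1 + p^-1%:E * \int[mu]_x k x)%E.
Proof.
move=> p0 mp muT mf mk f0 fk.
have m0 : 0 <= m by rewrite -lee_fin -muT measure_ge0.
have k0 x : (0 <= k x)%E by exact: le_trans (expeR_ge0 _) (fk x).
have K0 : (0 <= \int[mu]_x k x)%E by exact: integral_ge0.
have pf0 x : (0 <= p%:E * f x)%E by rewrite mule_ge0// lee_fin ltW.
have : (0 <= \int[mu]_x f x)%E by exact: integral_ge0.
case Ef : (\int[mu]_x f x)%E => [N| |] // N0; last first.
  (* If [f] has infinite integral, so has [k], since [k >= expeR (p f) >= 1 + p f]. *)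
  suff -> : (\int[mu]_x k x = +oo)%E.
    by rewrite gt0_muley ?lte_fin ?invr_gt0// addey.
  apply/eqP; rewrite -leye_eq.
  have <- : (\int[mu]_x (p%:E * f x) = +oo)%E.
    rewrite ge0_integralZl_EFin//; last exact: ltW.
    by rewrite Ef gt0_muley ?lte_fin.
  apply: ge0_le_integral_nonmeasurable => // x _.
  apply: le_trans (fk x); apply: le_trans (expeR_ge1Dx _).
  by rewrite leeDr.
rewrite lee_fin in N0.
have : (\int[mu]_x ((expR N)%:E + (p * expR N)%:E * f x) <=
        \int[mu]_x (k x + (expR N * N)%:E))%E.
  apply: ge0_le_integral_nonmeasurable => x _.
    by rewrite adde_ge0// mule_ge0// lee_fin mulr_ge0 ?ltW// expR_gt0.
  apply: le_trans (leeD2r _ (fk x)).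
  have := f0 x; case: (f x) => [r| |]//= r0; last first.
    by rewrite [(p%:E * _)%E]gt0_muley ?lte_fin//= leey.
  rewrite lee_fin in r0; rewrite -!EFinM/= lee_fin.
  have e1 := expR_ge1Dx (p * r - N).
  have -> : expR (p * r) = expR N * expR (p * r - N).
    by rewrite -expRD; congr expR; ring.
  have := ler_wpM2l (expR_ge0 N) e1; nra.
have eN0 : 0 <= expR N by exact: expR_ge0.
have en0 : 0 <= expR N * N by exact: mulr_ge0.
have pe0 : 0 <= p * expR N by rewrite mulr_ge0// ltW.
rewrite ge0_integralD//=; last 2 first.
  by move=> x _; rewrite mule_ge0// lee_fin.
  exact: measurable_funeM.
rewrite ge0_integralD//= !integral_cst//= ge0_integralZl_EFin// Ef muT.
case: (\int[mu]_x k x)%E K0 => [I| |]// I0; last first; first move=> _.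
  by rewrite gt0_muley ?lte_fin ?invr_gt0// addey// leey.
rewrite -!EFinM -!EFinD !lee_fin => h.
rewrite -(ler_pM2l p0) mulrDr mulr1 mulrA divff ?gt_eqF// mul1r.
(* This is [exp (-N) >= 1 - N] times [exp N]. Multiplied by [p - m >= 0], it absorbs the gap between
   the true mass [m] and [p]. *)
have h1 : 0 <= 1 - expR N + N * expR N.
  have := ler_wpM2l eN0 (expR_ge1Dx (- N)).
  by rewrite -expRD subrr expR0; lra.
have := mulr_ge0 (ltac:(by rewrite subr_ge0) : 0 <= p - m) h1; nra.
Qed.

(** * The logarithmic singularity and its geometric majorant *)

Definition neglog {R : realType} (u : R) : \bar R := maxe 0%E (- elog `|u|)%E.

(* The n-th term dominates |u|^-p on the annulus e^-(n+1) < |u| <= e^-n. *)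
Definition annuli_series {R : realType} (p u : R) : \bar R :=
  (\sum_(n <oo) (expR (p * n.+1%:R) * (`|u| <= expR (- n%:R))%R%:R)%:E)%E.

Lemma elog_le (R : realType) (x z : R) : 0 <= x -> x <= z -> (elog x <= elog z)%E.
Proof.
move=> x0 xz; rewrite /elog; have [_|xN0] := eqVneq x 0; first by rewrite leNye.
have xpos : 0 < x by rewrite lt_def xN0.
have zpos : 0 < z by exact: lt_le_trans xz.
by rewrite gt_eqF// lee_fin ler_ln.
Qed.

Lemma measurable_elog (R : realType) : measurable_fun [set: R] (@elog R).
Proof.
rewrite (_ : elog = fun x => if x == 0 then -oo%E else (ln x)%:E)//.
apply: measurable_fun_ifT => //.
  exact: (@measurable_fun_eqr _ _ _ _ id (cst 0)).
apply/measurable_EFinP; exact: measurable_ln.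
Qed.

Lemma measurable_neglog (R : realType) : measurable_fun [set: R] (@neglog R).
Proof.
apply: measurable_maxe => //; apply: measurableT_comp => //.
apply: measurableT_comp => //; exact: measurable_elog.
Qed.

Lemma neglog_ge0 (R : realType) (u : R) : (0 <= neglog u)%E.
Proof. by rewrite le_max lexx. Qed.

Lemma annuli_term_ge0 (R : realType) (p u : R) n :
  (0 <= (expR (p * n.+1%:R) * (`|u| <= expR (- n%:R))%R%:R)%:E)%E.
Proof. by rewrite lee_fin mulr_ge0// expR_ge0. Qed.

Lemma annuli_series_ge0 (R : realType) (p u : R) : (0 <= annuli_series p u)%E.
Proof. by apply: nneseries_ge0 => n _ _; exact: annuli_term_ge0. Qed.

Lemma annuli_term_le (R : realType) (p u : R) n : `|u| <= expR (- n%:R) ->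
  ((expR (p * n.+1%:R))%:E <= annuli_series p u)%E.
Proof.
move=> un.
have /(_ n.+1) := @nneseries_lim_ge R _ xpredT 0 ^~ (fun k _ _ => annuli_term_ge0 R p u k).
apply: le_trans; rewrite big_nat_recr//= un mulr1 leeDr//.
by apply: sume_ge0 => k _; exact: annuli_term_ge0.
Qed.

Lemma annuli_series0 (R : realType) (p : R) : 0 < p ->
  annuli_series p 0 = +oo%E.
Proof.
move=> p0; apply/eqyP => r _.
(* At [0] every annulus condition holds, so one term exceeding [r] is enough: this [n] gives
   [p (n+1) > |r|], and [exp x >= 1 + x]. *)
pose n := Num.truncn (`|r| / p).
apply: le_trans (annuli_term_le _ p 0 n _); last by rewrite normr0 expR_ge0.
have := truncnS_gt (`|r| / p); rewrite -/n ltr_pdivrMr// => h.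
have := expR_ge1Dx (p * n.+1%:R); have := ler_norm r.
by rewrite lee_fin; lra.
Qed.

(** For [|u| > 1] the left side is [1]. For [0 < |u| <= 1], with [n] the integer part of [- ln |u|],
    it is [|u|^-p <= exp (p (n+1))], the n-th term of the series. At [u = 0] the series diverges. *)
Lemma expeR_neglog_le (R : realType) (p u : R) : 0 < p ->
  (expeR (p%:E * neglog u) <= 1 + annuli_series p u)%E.
Proof.
move=> p0; have [->|u0] := eqVneq u 0.
  by rewrite annuli_series0// addey// leey.
have nu : 0 < `|u| by rewrite normr_gt0.
rewrite /neglog /elog normr_eq0 (negbTE u0) -EFinN -EFin_max -EFinM/=.
have [lu|lu] := leP 0 (- ln `|u|); last first.
  by rewrite mulr0 expR0 leeDl// annuli_series_ge0.
pose n := Num.truncn (- ln `|u|).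
have /andP[n1 n2] : n%:R <= - ln `|u| < n.+1%:R by exact: truncn_itv.
apply: (@le_trans _ _ (expR (p * n.+1%:R))%:E).
  by rewrite lee_fin ler_expR ler_pM2l// ltW.
have un : `|u| <= expR (- n%:R) by rewrite -[`|u|]lnK// ler_expR lerNr.
by apply: le_trans (annuli_term_le _ p u n un) _; rewrite leeDr.
Qed.

Lemma measurable_annuli_term (R : realType) (p : R) n :
  measurable_fun [set: R]
    (fun u : R => (expR (p * n.+1%:R) * (`|u| <= expR (- n%:R))%R%:R)%:E).
Proof.
apply/measurable_EFinP; apply: measurable_funM => //.
rewrite (_ : (fun _ => _) = (fun u : R => if `|u| <= expR (- n%:R) then 1 else 0)); last first.
  by apply/funext => u; case: ifP.
apply: measurable_fun_ifT => //.
exact: measurable_fun_ler.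
Qed.

Lemma measurable_annuli_series (R : realType) (p : R) :
  measurable_fun [set: R] (annuli_series p).
Proof.
apply: (ge0_emeasurable_sum (P := xpredT)) => [k u _ _|k _].
  exact: annuli_term_ge0.
exact: measurable_annuli_term.
Qed.

(** The indicator is that of an interval of length [2 exp (-n)] centred at [x]; the factor
    [exp (p (n+1))] then leaves a geometric term of ratio [exp (p - 1)], which is below 1 when
    [p < 1]. *)
Lemma integral_annuli_term (R : realType) (p x : R) n :
  (\int[lebesgue_measure]_t
     (expR (p * n.+1%:R) * (`|(t - x : R)| <= expR (- n%:R))%R%:R)%:E =
   (2 * expR p * expR (p - 1) ^+ n)%:E)%E.
Proof.
pose r := expR (- n%:R) : R; have r0 : 0 < r by exact: expR_gt0.
transitivity (\int[lebesgue_measure]_t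
  ((expR (p * n.+1%:R))%:E * (\1_(`[x - r, x + r]%classic) t)%:E))%E.
  apply: eq_integral => t _; rewrite -EFinM indicE; congr (_ * _%:R)%:E.
  by rewrite mem_setE in_itv/= ler_distl.
rewrite ge0_integralZl_EFin ?expR_ge0//; last first.
  by apply/measurable_EFinP; exact: measurable_indic.
rewrite integral_indic// setIT /= lebesgue_measure_itv/= lte_fin.
rewrite ltrD2l gtrN// -EFinB -EFinM; congr EFin.
rewrite /r -expRM_natl.
have h : expR (p * n.+1%:R) * expR (- n%:R) = expR p * expR (n%:R * (p - 1)).
  by rewrite -!expRD -natr1; congr expR; ring.
by rewrite -mulrA -h; ring.
Qed.

Lemma integral_annuli_series (R : realType) (p x : R) : p < 1 ->
  (\int[lebesgue_measure]_t annuli_series p (t - x)%R =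
   (2 * expR p / (1 - expR (p - 1)))%:E)%E.
Proof.
move=> p1.
rewrite integral_nneseries//; last first.
  move=> n; apply: measurableT_comp (measurable_annuli_term _ p n) _.
  exact: measurable_funB.
rewrite (eq_eseriesr (fun n _ => integral_annuli_term R p x n)).
have q1 : `|expR (p - 1)| < 1.
  by rewrite ger0_norm ?expR_ge0// -[ltRHS]expR0 ltr_expR subr_lt0.
apply/cvg_lim => //; apply: cvg_EFin.
  by apply: nearW => k; rewrite sumEFin.
rewrite [X in X @ _ --> _](_ : _ = series (geometric (2 * expR p) (expR (p - 1)))).
  exact: cvg_geometric_series.
by apply/funext => k; rewrite /= sumEFin.
Qed.

(** * Pointwise bounds for the potential and the arc length density *)

Lemma oppe_log_potential_le (R : realType)
    (mu : {measure set (R * R)%type -> \bar R}) (z : R * R) :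
  (- log_potential mu z <= \int[mu]_zeta neglog (z.1 - zeta.1)%R)%E.
Proof.
rewrite /log_potential integralE.
(* This includes P = N = +oo, where P - N is -oo. *)
have oppB_le (P N : \bar R) : (0 <= P -> 0 <= N -> - (P - N) <= N)%E.
  case: P => [P| |]// P0; case: N => [N| |]// N0; rewrite ?leey ?leNye//.
  by move: P0 N0; rewrite -EFinB -EFinN !lee_fin; lra.
apply: le_trans (oppB_le _ _ _ _) _; [exact: integral_ge0..|].
apply: ge0_le_integral_nonmeasurable => // zeta _.
rewrite funenegE /neglog maxC; apply: le_max2 => //.
rewrite leeN2; apply: elog_le => //.
by rewrite /cdist -sqrtr_sqr ler_wsqrtr// lerDl sqr_ge0.
Qed.

(* Where y is not differentiable, derive1 y t is the junk value 0. *)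
Lemma derive1_le_lipschitz (R : realType) (L a b : R) (y : R -> R) (t : R) :
  a < b -> lipschitz_on_itv L a b y -> t \in `[a, b] ->
  `|derive1 y t| <= L.
Proof.
move=> ab yL tab.
(* The Lipschitz bound between the endpoints forces [L >= 0], which settles the junk value. *)
have L0 : 0 <= L.
  have nab : 0 < `|a - b| by rewrite normr_gt0 subr_eq0 lt_eqF.
  rewrite -(pmulr_lge0 _ nab); apply: le_trans (yL _ _ _ _) => //;
    by rewrite in_itv/= lexx ltW.
rewrite /derive1.
set q := (fun h => _).
have [cvq|/dvgP ->] := pselect (cvg (q @ 0^')); last by rewrite normr0.
have qL h : h != 0 -> h + t \in `[a, b] -> `|q h| <= L.
  move=> h0 hab; rewrite /q normrZ normfV mulrC ler_pdivrMr ?normr_gt0//.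
  by have := yL _ _ hab tab; rewrite addrK.
move: tab; rewrite in_itv/= => /andP[ta tb].
(* The Lipschitz bound holds only inside [[a, b]], so the limit is taken from the right when [t < b]
   and from the left when [t = b]. *)
have [tltb|bt] := ltP t b.
  have qlim := cvg_dnbhs_at_right cvq.
  apply: (@cvgr_to_le _ _ _ _ (fun h => `|q h|) _ L) (cvg_norm qlim) _.
  have bt0 : 0 < b - t by rewrite subr_gt0.
  near=> h; apply: qL; first by rewrite gt_eqF.
  rewrite in_itv/= (le_trans ta) ?lerDr//= -lerBrDr.
  by near: h; apply: nbhs_right_le.
have qlim := cvg_dnbhs_at_left cvq.
  apply: (@cvgr_to_le _ _ _ _ (fun h => `|q h|) _ L) (cvg_norm qlim) _.
have at0 : a - t < 0 by rewrite subr_lt0; exact: lt_le_trans bt.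
near=> h; apply: qL; first by rewrite lt_eqF.
rewrite in_itv/= -lerBlDr (le_trans _ tb) ?gerDr// andbT.
by near: h; apply: nbhs_left_ge.
Unshelve. all: by end_near. Qed.

(** * Tonelli's theorem for the averaged majorant *)

Lemma measurable_annuli_prod (R : realType) (p : R) :
  measurable_fun [set: R * (R * R)] (fun z => annuli_series p (z.1 - z.2.1)%R).
Proof.
apply: measurableT_comp (measurable_annuli_series R p) _.
apply: measurable_funB => //.
exact: measurableT_comp measurable_fst measurable_snd.
Qed.

(** After exchanging the integrals, the inner one is a translate of the same function of [t], hence
    a constant independent of [zeta]. *)
Lemma integral_annuli_potential (R : realType) (p : R)
    (mu : {sigma_finite_measure set (R * R)%type -> \bar R}) : p < 1 ->
  (\int[lebesgue_measure]_t \int[mu]_zeta annuli_series p (t - zeta.1)%R =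
   (2 * expR p / (1 - expR (p - 1)))%:E * mu setT)%E.
Proof.
move=> p1.
transitivity
  (\int[mu]_zeta \int[lebesgue_measure]_t annuli_series p (t - zeta.1)%R)%E.
  apply: (@fubini_tonelli _ _ _ _ R (@lebesgue_measure R) mu
    (fun z => annuli_series p (z.1 - z.2.1)%R)).
    exact: measurable_annuli_prod.
  by move=> z; exact: annuli_series_ge0.
under eq_integral do rewrite integral_annuli_series//.
by rewrite integral_cst.
Qed.

Lemma measurable_annuli_potential (R : realType) (p : R)
    (mu : {sigma_finite_measure set (R * R)%type -> \bar R}) :
  measurable_fun [set: R]
    (fun t => \int[mu]_zeta annuli_series p (t - zeta.1)%R)%E.
Proof.
apply: (measurable_fun_fubini_tonelli_F
  (fun z : R * (R * R) => annuli_series p (z.1 - z.2.1)%R)).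
- exact: measurable_annuli_prod.
- by move=> z; exact: annuli_series_ge0.
Qed.

(** Jensen is applied with majorant [1 + annuli_series]. The constant 2 is Jensen's 1 plus
    [beta / p <= 1], the contribution of the summand 1. *)
Lemma expeR_oppe_log_potential_le (R : realType) (beta p : R)
    (mu : {measure set (R * R)%type -> \bar R}) (z : R * R) :
  0 < p -> beta <= p -> mu setT = beta%:E ->
  (expeR (- log_potential mu z) <=
   2%:E + p^-1%:E * \int[mu]_zeta annuli_series p (z.1 - zeta.1)%R)%E.
Proof.
move=> p0 bp muT.
have mB : measurable_fun [set: R * R] (fun zeta => z.1 - zeta.1).
  exact: measurable_funB.
have mn := measurableT_comp (measurable_neglog R) mB.
have ms := measurableT_comp (measurable_annuli_series R p) mB.
have s0 zeta : (0 <= annuli_series p (z.1 - zeta.1))%E by exact: annuli_series_ge0.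
apply: (@le_trans _ _ (expeR (\int[mu]_zeta neglog (z.1 - zeta.1)%R))).
  by rewrite lee_expeR; exact: oppe_log_potential_le.
apply: le_trans (expeR_integral_le _ _ _ mu beta p _
  (fun zeta => 1 + annuli_series p (z.1 - zeta.1)%R)%E p0 bp muT mn _ _ _) _.
- exact: emeasurable_funD.
- by move=> zeta; exact: neglog_ge0.
- by move=> zeta; exact: expeR_neglog_le.
rewrite ge0_integralD// integral_cst// mul1e muT.
rewrite ge0_muleDr ?integral_ge0//; last by rewrite -muT measure_ge0.
rewrite addeA leeD2r// -EFinM -EFinD lee_fin.
by rewrite -[2]/(1 + 1) lerD2l mulrC ler_pdivrMr// mul1r.
Qed.

(** * The uniform bound for the line integral *)

Theorem theorem2p9 (R : realType) (L beta a b : R) :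
  a < b -> beta < 1 ->
  exists C : R, 0 < C /\
    forall (y : R -> R) (U : set (R * R)%type)
           (mu : {measure set (R * R)%type -> \bar R}),
      lipschitz_on_itv L a b y ->
      open U ->
      (forall t, t \in `[a, b] -> U (t, y t)) ->
      mu setT = beta%:E ->
      mu (~` U) = 0%E ->
      (arclength_integral a b y
         (fun z => expeR (- log_potential mu z)) < C%:E)%E.
Proof.
move=> ab b1.
pose p : R := Num.max beta 2^-1.
have p0 : 0 < p by rewrite lt_max invr_gt0 ltr0n orbT.
have bp : beta <= p by rewrite le_max lexx.
have p1 : p < 1 by rewrite gt_max b1 invf_lt1// ltr1n.
pose C0 := 2 * expR p / (1 - expR (p - 1)).
have C00 : 0 <= C0.
  rewrite divr_ge0 ?mulr_ge0 ?expR_ge0// subr_ge0 -[leRHS]expR0 ler_expR.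
  by rewrite subr_le0 ltW.
pose S := Num.sqrt (1 + L ^+ 2).
(* [S] bounds the arc length density, [2 (b - a)] integrates the constant 2, [C0] bounds the
   averaged majorant divided by [p], and the final 1 makes the inequality strict. *)
exists (S * (2 * (b - a) + C0) + 1); split.
  by rewrite ltr_wpDl// mulr_ge0 ?sqrtr_ge0// addr_ge0// mulr_ge0// subr_ge0 ltW.
move=> y U mu0 yL _ _ mu0T _.
have sfin : sigma_finite setT mu0.
  exists (fun=> setT); first by rewrite bigcup_const.
  by move=> _; split => //; rewrite mu0T ltry.
(* Tonelli requires a sigma-finite measure; finite total mass lets [mu0] be repackaged as one. *)
pose H1 := isSFinite.Build _ _ _ _ (sfinite_measure_sigma_finite sfin).
pose H2 := isSigmaFinite.Build _ _ _ _ sfin.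
pose mu := HB.pack_for (SigmaFiniteMeasure.type (R * R)%type R)
  (Measure.sort mu0) H1 H2.
have muT : mu setT = beta%:E by [].
pose H t := (\int[mu]_zeta annuli_series p (t - zeta.1)%R)%E.
have H0 t : (0 <= H t)%E by apply: integral_ge0 => zeta _; exact: annuli_series_ge0.
have mH : measurable_fun [set: R] H by exact: measurable_annuli_potential.
have SE : 0 <= S by exact: sqrtr_ge0.
have I0 : (0 <= p^-1%:E * H _)%E by move=> t; rewrite mule_ge0// lee_fin invr_ge0 ltW.
apply: (@le_lt_trans _ _ (S * (2 * (b - a) + C0))%:E); last by rewrite lte_fin ltrDl.
apply: (@le_trans _ _ (\int[lebesgue_measure]_(t in `[a, b])
   (S%:E * (2%:E + p^-1%:E * H t)))%E).
  apply: ge0_le_integral_nonmeasurable => t tab.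
    by rewrite mule_ge0 ?expeR_ge0// lee_fin sqrtr_ge0.
  rewrite muleC; apply: lee_pmul.
  - by rewrite lee_fin sqrtr_ge0.
  - exact: expeR_ge0.
  - have yt := derive1_le_lipschitz R L a b y t ab yL tab.
    rewrite lee_fin ler_wsqrtr// lerD2l -real_normK ?num_real//.
    by rewrite lerXn2r ?nnegrE// (le_trans _ yt).
  - exact: (expeR_oppe_log_potential_le R beta p mu (t, y t)).
have mpH : measurable_fun `[a, b] (fun t => p^-1%:E * H t)%E.
  by apply: measurable_funTS; exact: measurable_funeM.
have m2pH : measurable_fun `[a, b] (fun t => 2%:E + p^-1%:E * H t)%E.
  exact: emeasurable_funD.
have p2H t : (0 <= 2%:E + p^-1%:E * H t)%E by rewrite adde_ge0.
rewrite ge0_integralZl//.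
rewrite EFinM lee_pmul//.
  by apply: integral_ge0 => t _; rewrite adde_ge0.
rewrite ge0_integralD// integral_cst//= lebesgue_measure_itv/= lte_fin ab.
rewrite -EFinB -EFinM EFinD leeD2l//.
rewrite ge0_integralZl_EFin//; last 2 first.
- exact: measurable_funTS.
- by rewrite invr_ge0 ltW.
rewrite muleC lee_pdivrMr//.
(* As [H >= 0], the domain may grow to the whole line, where the integral is
   [C0 * beta <= C0 * p]. *)
apply: (@le_trans _ _ (\int[lebesgue_measure]_t H t)%E).
  exact: ge0_subset_integral.
rewrite integral_annuli_potential// -/C0 muT -EFinM lee_fin ler_wpM2l//.
Qed.
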